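(* Let $(T,X)$ be a semiflow on a compact Hausdorff space $X$ and let $M$ be a nonempty closed invariant subset of $X$ (i.e. $tM\subseteq M$ for all $t\in T$). If $(T,X)$ is equicontinuous and surjective, then the restricted semiflow $(T,M)$ is also equicontinuous and surjective.
   Context: $X$ is a nonempty compact Hausdorff space, $\mathscr U_X$ is its compatible uniformity (symmetric entourages), and $T$ is a discrete infinite semigroup with identity $e$. A semiflow $(T,X)$ is a continuous map $T\times X\to X$, $(t,x)\mapsto tx$, with $ex=x$ and $t(sx)=(ts)x$. $(T,X)$ is surjective if $tX=X$ for every $t\in T$. It is equicontinuous if for every $\varepsilon\in\mathscr U_X$ there is $\delta\in\mathscr U_X$ such that $(x,y)\in\delta$ implies $(tx,ty)\in\varepsilon$ for all $t\in T$. *)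

(* Defs.v *)
From mathcomp Require Import all_boot all_classical topology.

Set Implicit Arguments.
Unset Strict Implicit.
Unset Printing Implicit Defensive.

Local Open Scope classical_set_scope.

Record semiflow (T : monoidType) (X : topologicalType) := Semiflow {
  act :> T -> X -> X;
  act_continuous : continuous (fun p : discrete_topology T * X => act p.1 p.2);
  act1 : forall x : X, act 1%g x = x;
  actM : forall (t s : T) (x : X), act t (act s x) = act (t * s)%g x }.

Definition surjective_semiflow (T : monoidType) (X : topologicalType)
    (phi : semiflow T X) : Prop :=
  forall t : T, phi t @` [set: X] = [set: X].

Definition sym_entourage (X : uniformType) : set_system (X * X) :=
  [set E | entourage E /\ (E^-1)%relation = E].

(* This is uniform equicontinuity, whereas the library's [equicontinuous] is
   the pointwise notion. When [X] is compact Hausdorff its uniformity is the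
   only one inducing the topology. *)
Definition equicontinuous_semiflow (T : monoidType) (X : uniformType)
    (phi : semiflow T X) : Prop :=
  forall eps : set (X * X), sym_entourage eps ->
  exists2 delta : set (X * X), sym_entourage delta &
    forall x y : X, delta (x, y) -> forall t : T, eps (phi t x, phi t y).

Definition invariant_set (T : monoidType) (X : topologicalType)
    (phi : semiflow T X) (M : set X) : Prop :=
  forall t : T, phi t @` M `<=` M.

Section restriction.
Context (T : monoidType) (X : topologicalType) (phi : semiflow T X).
Context (M : set X) (invM : invariant_set phi M).

Definition restr_act (t : T) (x : M) : M :=
  exist _ (phi t (set_val x))
    (mem_set (invM (imageP (phi t) (set_valP x)))).

Lemma restr_act_continuous :
  continuous (fun p : discrete_topology T * M => restr_act p.1 p.2).
Proof.
apply: continuous_comp_initial => p.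
apply: (@continuous_comp _ _ _
  (fun q : discrete_topology T * M => (q.1, set_val q.2) : discrete_topology T * X)
  (fun q : discrete_topology T * X => phi q.1 q.2)); last first.
  exact: act_continuous.
apply: (@cvg_pair _ _ _ (nbhs p) (nbhs p.1) (nbhs (set_val p.2))).
  exact: cvg_fst.
apply: (@continuous_comp _ _ _ snd (set_val : M -> X)); first exact: cvg_snd.
exact: initial_continuous.
Qed.

Lemma restr_act1 (x : M) : restr_act 1%g x = x.
Proof. by apply: val_inj; exact: act1. Qed.

Lemma restr_actM (t s : T) (x : M) :
  restr_act t (restr_act s x) = restr_act (t * s)%g x.
Proof. by apply: val_inj; exact: actM. Qed.

(* [M], seen as a type, carries the subspace topology and, when [X] is a
   uniform space, the trace uniformity. *)
Definition restr_semiflow : semiflow T M :=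
  Semiflow restr_act_continuous restr_act1 restr_actM.

End restriction.

(* Main.v *)
(** The point is surjectivity on [M].  Given [y] in [M], choose a backward
    orbit [y = u 0], [f (u n.+1) = u n] of [f = phi t] in [X].  By compactness
    two terms [u m], [u n] with [m < n] are close, and applying the [n]-th
    iterate of [f], which is equicontinuous uniformly in [n], shows that
    [f^(n - m) y] is close to [y].  Hence [y] is in the closure of [f @` M],
    which is closed. *)
Require Import Defs.
From mathcomp Require Import all_boot all_classical topology.

Local Open Scope classical_set_scope.

Lemma entourage_sym_entourage {X : uniformType} (E : set (X * X)) :
  entourage E -> sym_entourage (E `&` E^-1%relation).
Proof.
move=> entE; split; first exact: entourage_invI.
by rewrite eqEsubset; split=> -[x y] [].
Qed.

(** By compactness [u] has a cluster point [z], and every tail of [u] comes close to [z]: pick [m],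
    then [n] in the tail from [m.+1], and pass through [z]. *)
Lemma compact_seq_close {X : uniformType} (u : nat -> X) (E : set (X * X)) :
  compact [set: X] -> entourage E ->
  exists m n : nat, (m < n)%N /\ E (u m, u n).
Proof.
move=> cX entE.
have [z [_ clz]] := cX (u @ \oo) _ (filterT : (u @ \oo) setT).
(* Both orders are needed since [z] is the middle point: the pairs used below are [(u m, z)] and
   [(z, u n)]. *)
have near_z N : exists2 n, (N <= n)%N &
    (split_ent E `&` (split_ent E)^-1%relation) (z, u n).
  have uN : (u @ \oo) (u @` [set n | (N <= n)%N]).
    by exists N => // n /= Nn; exists n.
  have nz := nbhs_entourage z (entourage_invI (entourage_split_ent entE)).
  have [_ [[n Nn <-]] /set_mem ?] := clz _ _ uN nz.
  by exists n.
have [m _ [_ zm]] := near_z 0%N.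
have [n mn [zn _]] := near_z m.+1.
by exists m, n; split=> //; exact: (entourage_split z).
Qed.

Section semiflow.
Context {T : monoidType} {X : topologicalType} (phi : semiflow T X).

(** Iterates of one action map are again action maps, so equicontinuity over [T] controls all of
    them with a single entourage. *)
Lemma act_iter (t : T) (n : nat) (x : X) : iter n (phi t) x = phi (t ^+ n)%g x.
Proof.
elim: n => [|n IHn]; first by rewrite expg0 act1.
by rewrite iterS IHn actM -expgS.
Qed.

Lemma continuous_act (t : T) : continuous (phi t).
Proof.
move=> x.
apply: (@continuous_comp _ _ _
  (fun y : X => (t, y) : discrete_topology T * X)
  (fun q : discrete_topology T * X => phi q.1 q.2)); last first.
  exact: act_continuous.
by apply: (@cvg_pair _ _ _ (nbhs x) (nbhs (t : discrete_topology T)) (nbhs x));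
  [exact: cvg_cst | exact: cvg_id].
Qed.

Lemma invariant_iter (M : set X) (t : T) (n : nat) (x : X) :
  invariant_set phi M -> M x -> M (iter n (phi t) x).
Proof.
by move=> invM Mx; rewrite act_iter; apply: (invM (t ^+ n)%g); exists x.
Qed.

End semiflow.

Lemma iter_backward_orbit {X : Type} {f : X -> X} {u : nat -> X} :
  (forall n, f (u n.+1) = u n) -> forall k n, iter k f (u (n + k)%N) = u n.
Proof.
move=> fu; elim=> [|k IHk] n; first by rewrite addn0.
by rewrite iterSr addnS fu IHk.
Qed.

Lemma equicontinuous_surjective_recurrent {T : monoidType} {X : uniformType}
    (phi : semiflow T X) :
  compact [set: X] -> equicontinuous_semiflow phi -> surjective_semiflow phi ->
  forall (t : T) (y : X) (E : set (X * X)), entourage E ->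
  exists k : nat, E (y, iter k.+1 (phi t) y).
Proof.
move=> cX equi surj t y E entE.
have [D [entD _] DE] := equi _ (entourage_sym_entourage E entE).
have /choice[g fg] : forall x : X, exists x' : X, phi t x' = x.
  move=> x; have : (phi t @` [set: X]) x by rewrite surj.
  by case=> x' _; exists x'.
pose u n := iter n g y.
have fu n : phi t (u n.+1) = u n by exact: fg.
have [m [n [mn Dmn]]] := compact_seq_close u D cX entD.
exists (n - m).-1; rewrite prednK ?subn_gt0//.
(* [phi (t ^+ n)] sends [u n] to [y] and [u m] to [iter (n - m) (phi t) y]. The goal has these two
   points in reverse order, hence the inverse half of the symmetrized entourage. *)
have [_] := DE _ _ Dmn (t ^+ n)%g.
rewrite -!act_iter.
have -> : iter n (phi t) (u n) = y by exact: (iter_backward_orbit fu n 0%N).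
rewrite -{1}(subnK (ltnW mn)) iterD.
by rewrite (iter_backward_orbit fu m 0%N).
Qed.

(** Backward orbits of a point of [M] may leave [M]; it is enough that the forward iterates, which
    approximate the point, stay in [M]. *)
Lemma image_closed_invariant {T : monoidType} {X : uniformType}
    (phi : semiflow T X) (M : set X) :
  compact [set: X] -> hausdorff_space X -> closed M -> invariant_set phi M ->
  equicontinuous_semiflow phi -> surjective_semiflow phi ->
  forall t : T, phi t @` M = M.
Proof.
move=> cX hX clM invM equi surj t; rewrite eqEsubset; split; first exact: invM.
move=> y My.
have cM : compact M by exact: subclosed_compact clM cX _.
have cfM : compact (phi t @` M).
  by apply: continuous_compact cM; apply: continuous_subspaceT;
    exact: continuous_act.
apply: (compact_closed hX cfM) => B /nbhsP[E entE EB].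
have [k Ek] := equicontinuous_surjective_recurrent phi cX equi surj t y E entE.
(* The count [k.+1] is positive, so the last application of [phi t] puts this point in the image of
   [M]. *)
exists (iter k.+1 (phi t) y); split; last by apply: EB; exact/mem_set.
by exists (iter k (phi t) y) => //; exact: invariant_iter.
Qed.

Lemma equicontinuous_restr {T : monoidType} {X : uniformType}
    (phi : semiflow T X) (M : set X) (invM : invariant_set phi M) :
  equicontinuous_semiflow phi -> equicontinuous_semiflow (restr_semiflow invM).
Proof.
(* An entourage of [M] contains the trace of an entourage [B] of [X]. *)
move=> equi E [[B entB BE] _].
have [D [entD _] DB] := equi _ (entourage_sym_entourage B entB).
pose D' : set (M * M) := [set p | D (set_val p.1, set_val p.2)].
have entD' : entourage D' by exists D => // -[].
exists (D' `&` D'^-1%relation); first exact: entourage_sym_entourage.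
by move=> x y [Dxy _] t; apply: BE; have [] := DB _ _ Dxy t.
Qed.

Theorem corollary1p15 (T : monoidType) (X : uniformType) (phi : semiflow T X)
    (M : set X)
    (T_infinite : infinite_set [set: T])
    (X_nonempty : [set: X] !=set0)
    (X_compact : compact [set: X])
    (X_hausdorff : hausdorff_space X)
    (M_nonempty : M !=set0)
    (M_closed : closed M)
    (M_invariant : invariant_set phi M)
    (phi_equicontinuous : equicontinuous_semiflow phi)
    (phi_surjective : surjective_semiflow phi) :
  equicontinuous_semiflow (restr_semiflow M_invariant) /\
  surjective_semiflow (restr_semiflow M_invariant).
Proof.
split; first exact: equicontinuous_restr.
move=> t; rewrite -subTset => y _.
have : (phi t @` M) (set_val y).
  by rewrite image_closed_invariant//; exact: set_valP.
case=> x Mx fxy; exists (exist _ x (mem_set Mx)) => //.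
exact: val_inj.
Qed.
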